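(* Let $f:\mathbb{R}^n\to\mathbb{R}$ be a $\mathcal{C}^1$-smooth function whose gradient $\nabla f$ is Lipschitz continuous on $\mathbb{R}^n$ with constant $L>0$. Let $\{x^k\}$, $\{g^k\}$, $\{\varepsilon_k\}$ be sequences generated by the inexact gradient descent (IGD) algorithm (described in the context) with scaling factor $\mu>2$, and assume that $\nabla f(x^k)\ne 0$ for all $k\in\mathbb{N}$. Then either $\|x^k\|\to\infty$ as $k\to\infty$, or $\varepsilon_k\downarrow 0$ as $k\to\infty$ and all of the following assertions hold: (i) Both sequences $\{\nabla f(x^k)\}$ and $\{g^k\}$ converge to $0\in\mathbb{R}^n$ as $k\to\infty$. (ii) If $f$ satisfies the KL property at some accumulation point $\bar x$ of $\{x^k\}$, then $x^k\to\bar x$ as $k\to\infty$. (iii) If $f$ satisfies the KL property at some accumulation point $\bar x$ of $\{x^k\}$ with $\psi(t)=Mt^{q}$ for some $M>0$ and $q\in(0,1)$, then the following convergence rates hold: - if $q\in(0,1/2]$, the sequences $\{x^k\}$, $\{f(x^k)\}$ and $\{\nabla f(x^k)\}$ converge linearly to $\bar x$, $f(\bar x)$ and $0\in\mathbb{R}^n$, respectively; - if $q\in(1/2,1)$, then as $k\to\infty$ $$\|x^k-\bar x\|=\mathcal{O}\Big(k^{-\frac{1-q}{2q-1}}\Big),\qquad f(x^k)-f(\bar x)=\mathcal{O}\Big(k^{-\frac{2-2q}{2q-1}}\Big),\qquad \|\nabla f(x^k)\|=\mathcal{O}\Big(k^{-\frac{1-q}{2q-1}}\Big).$$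
   Context: $\|\cdot\|$ is the Euclidean norm on $\mathbb{R}^n$ and $\mathbb{N}=\{1,2,\dots\}$. The notation $\varepsilon_k\downarrow0$ means that $\{\varepsilon_k\}$ is nonincreasing and converges to $0$. IGD algorithm. Step 0: select an initial point $x^1\in\mathbb{R}^n$, an initial error $\varepsilon_1>0$, an error reduction factor $\theta\in(0,1)$ and a scaling factor $\mu>1$; set $k:=1$. Step 1: find $g^k\in\mathbb{R}^n$ and the smallest integer $i_k\in\{0,1,2,\dots\}$ such that $$\|g^k-\nabla f(x^k)\|\le\theta^{i_k}\varepsilon_k\quad\text{and}\quad\|g^k\|>\mu\,\theta^{i_k}\varepsilon_k.$$ Step 2: set $x^{k+1}:=x^k-\frac1L g^k$ and $\varepsilon_{k+1}:=\theta^{i_k}\varepsilon_k$; increase $k$ by $1$ and go back to Step 1. Step 1 is performed as follows: start with $i_k=0$ and choose some $g^k$ satisfying the first inequality; as long as the second inequality fails, increase $i_k$ by $1$ and choose again some $g^k$ satisfying the first inequality with the new $i_k$; ''smallest'' refers to the first value of $i_k$ at which this procedure stops. (The procedure stops after finitely many trials when $\nabla f(x^k)\neq0$.) KL property: a differentiable function $f:\mathbb{R}^n\to\mathbb{R}$ satisfies the KL (Kurdyka-Łojasiewicz) property at $\bar x\in\mathbb{R}^n$ if there exist a number $\eta>0$, a neighborhood $U$ of $\bar x$, and a nondecreasing function $\psi:(0,\eta)\to(0,\infty)$ such that $1/\psi$ is integrable over $(0,\eta)$ and $$\|\nabla f(x)\|\ge\psi\big(f(x)-f(\bar x)\big)\quad\text{for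 all }x\in U\text{ with }f(\bar x)<f(x)<f(\bar x)+\eta.$$ ''KL property at $\bar x$ with $\psi(t)=Mt^q$'' means that this holds with that particular function $\psi$ (for some $\eta>0$ and some neighborhood $U$). A sequence $\{z^k\}$ converges linearly to $\bar z$ if there are $c>0$ and $t\in(0,1)$ with $\|z^k-\bar z\|\le c\,t^k$ for all sufficiently large $k$. *)

(* Defs.v *)
From mathcomp Require Export all_boot all_order all_algebra.
From mathcomp Require Export all_classical all_reals all_analysis.

Set Implicit Arguments.
Unset Strict Implicit.
Unset Printing Implicit Defensive.

Export Order.TTheory GRing.Theory Num.Theory.
Export numFieldNormedType.Exports.

Local Open Scope classical_set_scope.
Local Open Scope ring_scope.

(* The library's norm on 'rV[R]_n is the sup norm; it induces the Euclidean
   topology, so limits, neighborhoods, continuity and differentiability on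
   'rV[R]_n are the library's, but quantitative bounds must use enorm. *)
Definition enorm (R : realType) (n : nat) (v : 'rV[R]_n) : R :=
  Num.sqrt (\sum_(i < n) v ord0 i ^+ 2).

Definition grad (R : realType) (n : nat) (f : 'rV[R]_n -> R) (x : 'rV[R]_n) :
  'rV[R]_n := \row_(i < n) 'D_(delta_mx ord0 i) f x.

Definition C1_smooth (R : realType) (n : nat) (f : 'rV[R]_n -> R) : Prop :=
  (forall x, differentiable f x) /\ continuous (grad f).

Definition lipschitz_gradient (R : realType) (n : nat) (f : 'rV[R]_n -> R)
    (L : R) : Prop :=
  forall x y, enorm (grad f x - grad f y) <= L * enorm (x - y).

(* One execution of Step 1 at a point with gradient G and current error e,
   returning the direction g after i rejected trials. The trial vectors are
   chosen anew for each exponent, so minimality of i means that at each j < i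
   some admissible trial h failed the second test; it does not say that no
   vector passes both tests at j. *)
Definition igd_search (R : realType) (n : nat) (theta mu : R) (G : 'rV[R]_n)
    (e : R) (g : 'rV[R]_n) (i : nat) : Prop :=
  [/\ enorm (g - G) <= theta ^+ i * e,
      mu * (theta ^+ i * e) < enorm g &
      forall j, (j < i)%N -> exists h : 'rV[R]_n,
        enorm (h - G) <= theta ^+ j * e /\ ~ (mu * (theta ^+ j * e) < enorm h)].

(* Sequences are indexed from 1; their values at 0 are irrelevant. *)
Definition igd_sequences (R : realType) (n : nat) (f : 'rV[R]_n -> R)
    (L theta mu : R) (x g : nat -> 'rV[R]_n) (eps : nat -> R) : Prop :=
  0 < eps 1%N /\
  exists i : nat -> nat, forall k, (1 <= k)%N ->
    [/\ igd_search theta mu (grad f (x k)) (eps k) (g k) (i k),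
        x k.+1 = x k - L^-1 *: g k &
        eps k.+1 = theta ^+ i k * eps k].

(* psi is a function on (0, eta); its values elsewhere are irrelevant. *)
Definition KL_property_with (R : realType) (n : nat) (f : 'rV[R]_n -> R)
    (xbar : 'rV[R]_n) (psi : R -> R) : Prop :=
  exists (eta : R) (U : set 'rV[R]_n),
    [/\ 0 < eta /\ nbhs xbar U,
        forall t, 0 < t < eta -> 0 < psi t,
        forall s t, 0 < s -> s <= t -> t < eta -> psi s <= psi t,
        (@lebesgue_measure R).-integrable `]0, eta[%classic
          (fun t : R => ((psi t)^-1)%:E) &
        forall y, U y -> f xbar < f y < f xbar + eta ->
          psi (f y - f xbar) <= enorm (grad f y)].

Definition KL_property (R : realType) (n : nat) (f : 'rV[R]_n -> R)
    (xbar : 'rV[R]_n) : Prop :=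
  exists psi : R -> R, KL_property_with f xbar psi.

Definition accumulation_point (R : realType) (n : nat) (x : nat -> 'rV[R]_n)
    (xbar : 'rV[R]_n) : Prop := cluster (x @ \oo) xbar.

(* Linear convergence of z to zbar, with respect to a given norm N: enorm for
   vectors, the absolute value for scalars. *)
Definition converges_linearly (R : realType) (V : zmodType) (N : V -> R)
    (z : nat -> V) (zbar : V) : Prop :=
  exists c t : R,
    [/\ 0 < c, 0 < t < 1 &
        \forall k \near \oo, N (z k - zbar) <= c * t ^+ k].

(* Main.v *)
(* A trial direction that passes the test of Step 1 has relative error below
   1/mu < 1/2, so each step decreases f by at least a multiple of |g k|^2 and
   |grad f (x k)| <= 2 |g k|. If the iterates do not escape to infinity they have
   an accumulation point a; then f (x k) decreases to f a, whence g k, grad f (x k)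
   and eps k tend to 0. Under the KL property, the increments of
   phi (f (x k) - f a), with phi a primitive of 1/psi, dominate the step lengths,
   which traps the iterates near a. For psi t = M t^q, phi is a multiple of
   t^(1-q) and bounds |x k - a|, while r k = f (x k) - f a satisfies
   c (r k)^(2q) <= r k - r (k+1), from which the rates follow. *)
Require Import Defs.
From mathcomp Require Import ring lra.

Set Implicit Arguments.
Unset Strict Implicit.
Local Open Scope classical_set_scope.
Local Open Scope ring_scope.


(** * Euclidean inner product and norm, and their link to the topology of row vectors *)

Definition dotp (R : realType) (n : nat) (u v : 'rV[R]_n) : R :=
  \sum_(i < n) u ord0 i * v ord0 i.

Lemma enorm_ge0 (R : realType) (n : nat) (v : 'rV[R]_n) : 0 <= enorm v.
Proof. exact: sqrtr_ge0. Qed.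

Lemma enorm_sqr (R : realType) (n : nat) (v : 'rV[R]_n) :
  enorm v ^+ 2 = dotp v v.
Proof.
rewrite /enorm sqr_sqrtr; last by apply: sumr_ge0 => i _; exact: sqr_ge0.
by apply: eq_bigr => i _; rewrite expr2.
Qed.

Lemma dotpDr (R : realType) (n : nat) (u v w : 'rV[R]_n) :
  dotp u (v + w) = dotp u v + dotp u w.
Proof.
by rewrite -big_split/=; apply: eq_bigr => i _; rewrite mxE mulrDr.
Qed.

Lemma dotpC (R : realType) (n : nat) (u v : 'rV[R]_n) : dotp u v = dotp v u.
Proof. by apply: eq_bigr => i _; rewrite mulrC. Qed.

Lemma dotpZr (R : realType) (n : nat) (u v : 'rV[R]_n) (a : R) :
  dotp u (a *: v) = a * dotp u v.
Proof.
by rewrite mulr_sumr; apply: eq_bigr => i _; rewrite mxE mulrCA.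
Qed.

Lemma dotpBl (R : realType) (n : nat) (u v w : 'rV[R]_n) :
  dotp (u - v) w = dotp u w - dotp v w.
Proof. by rewrite dotpC dotpDr -scaleN1r dotpZr mulN1r dotpC (dotpC w). Qed.

Lemma enorm0 (R : realType) (n : nat) : enorm (0 : 'rV[R]_n) = 0.
Proof.
by rewrite /enorm big1 ?sqrtr0// => i _; rewrite mxE expr0n.
Qed.

Lemma enormZ (R : realType) (n : nat) (a : R) (v : 'rV[R]_n) :
  enorm (a *: v) = `|a| * enorm v.
Proof.
rewrite -sqrtr_sqr /enorm -sqrtrM ?sqr_ge0// mulr_sumr; congr Num.sqrt.
by apply: eq_bigr => i _; rewrite mxE exprMn.
Qed.

Lemma enormN (R : realType) (n : nat) (v : 'rV[R]_n) : enorm (- v) = enorm v.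
Proof. by rewrite -scaleN1r enormZ normrN1 mul1r. Qed.

Lemma enorm_distC (R : realType) (n : nat) (u v : 'rV[R]_n) :
  enorm (u - v) = enorm (v - u).
Proof. by rewrite -enormN opprB. Qed.

Lemma coord_le_enorm (R : realType) (n : nat) (v : 'rV[R]_n) i :
  `|v ord0 i| <= enorm v.
Proof.
rewrite -sqrtr_sqr /enorm ler_sqrt; last first.
  by apply: sumr_ge0 => j _; exact: sqr_ge0.
by rewrite (bigD1 i)//= lerDl; apply: sumr_ge0 => j _; exact: sqr_ge0.
Qed.

Lemma norm_le_enorm (R : realType) (n : nat) (v : 'rV[R]_n) : `|v| <= enorm v.
Proof.
rewrite [X in X <= _]mx_normrE; apply: bigmax_le; first exact: enorm_ge0.
by move=> [i j] _; rewrite /= (ord1 i); exact: coord_le_enorm.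
Qed.

(** The crude factor [n] in place of its square root suffices: only the equivalence of the two norms
    is needed, to identify neighborhoods. *)
Lemma enorm_le_norm (R : realType) (n : nat) (v : 'rV[R]_n) :
  enorm v <= n%:R * `|v|.
Proof.
rewrite -(ler_pXn2r (ltn0Sn 1)) ?nnegrE ?enorm_ge0 ?mulr_ge0//.
rewrite enorm_sqr (@le_trans _ _ (\sum_(i < n) `|v| ^+ 2))//.
  apply: ler_sum => i _; rewrite -expr2 -real_normK ?num_real//.
  rewrite ler_pXn2r ?nnegrE//.
  by rewrite [leRHS]mx_normrE; apply: (le_bigmax _ _ (ord0, i)).
rewrite sumr_const card_ord exprMn -[leLHS]mulr_natl ler_wpM2r ?sqr_ge0//.
by rewrite -natrX ler_nat; case: n {v} => // n; rewrite leq_pmulr.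
Qed.

Lemma enorm_eq0 (R : realType) (n : nat) (v : 'rV[R]_n) : enorm v = 0 -> v = 0.
Proof.
by move=> v0; apply/normr0_eq0/le_anti; rewrite normr_ge0 -v0 norm_le_enorm.
Qed.

(** Cauchy-Schwarz, by expanding the square of the norm of [enorm v *: u - enorm u *: v]; the
    degenerate cases are split off so that the positive factor [enorm u * enorm v] can be
    cancelled. *)
Lemma dotp_le (R : realType) (n : nat) (u v : 'rV[R]_n) :
  dotp u v <= enorm u * enorm v.
Proof.
have [u0|u0] := eqVneq (enorm u) 0.
  by rewrite u0 mul0r (enorm_eq0 u0) /dotp big1// => i _; rewrite mxE mul0r.
have [v0|v0] := eqVneq (enorm v) 0.
  by rewrite v0 mulr0 (enorm_eq0 v0) /dotp big1// => i _; rewrite mxE mulr0.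
have {}u0 : 0 < enorm u by rewrite lt_def u0 enorm_ge0.
have {}v0 : 0 < enorm v by rewrite lt_def v0 enorm_ge0.
have := sqr_ge0 (enorm (enorm v *: u - enorm u *: v)).
rewrite enorm_sqr dotpBl !(dotpC _ (_ - _)) !dotpBl.
rewrite !dotpZr !(dotpC (_ *: _)) !dotpZr -!enorm_sqr (dotpC v u).
set a := enorm u in u0 *; set b := enorm v in v0 *; set d := dotp _ _ => H.
have : 0 <= (a * b) * (a * b - d) by nra.
by rewrite pmulr_rge0 ?mulr_gt0// subr_ge0.
Qed.

Lemma enormD (R : realType) (n : nat) (u v : 'rV[R]_n) :
  enorm (u + v) <= enorm u + enorm v.
Proof.
rewrite -(ler_pXn2r (ltn0Sn 1)) ?nnegrE ?addr_ge0 ?enorm_ge0//.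
rewrite enorm_sqr dotpDr !(dotpC (_ + _)) !dotpDr -!enorm_sqr (dotpC v u).
by have := dotp_le u v; nra.
Qed.

Lemma enorm_triangle (R : realType) (n : nat) (u v w : 'rV[R]_n) :
  enorm (u - w) <= enorm (u - v) + enorm (v - w).
Proof. by rewrite -[u - w](subrKA v) enormD. Qed.

Lemma nbhs_enorm (R : realType) (n : nat) (a : 'rV[R]_n) (U : set 'rV[R]_n) :
  nbhs a U <-> exists2 e, 0 < e & forall y, enorm (y - a) < e -> U y.
Proof.
split=> [/nbhs_ballP[e /= e0 eU]|[e e0 eU]].
  exists e => // y ye; apply: eU; rewrite -ball_normE/= distrC.
  exact: le_lt_trans (norm_le_enorm _) ye.
have d0 : 0 < e / n.+1%:R by rewrite divr_gt0.
apply/nbhs_ballP; exists (e / n.+1%:R) => //= y; rewrite -ball_normE/= distrC => ye.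
apply: eU; rewrite (le_lt_trans (enorm_le_norm _))//.
rewrite ltr_pdivlMr// in ye; apply: le_lt_trans ye.
by rewrite mulrC ler_wpM2l// ler_nat.
Qed.

Lemma cvg_enorm (R : realType) (n : nat) (z : nat -> 'rV[R]_n) (a : 'rV[R]_n) :
  (forall e, 0 < e -> exists N, forall k, (N <= k)%N -> enorm (z k - a) < e) ->
  z k @[k --> \oo] --> a.
Proof.
move=> H U /nbhs_enorm[e e0 eU]; have [N HN] := H e e0.
by exists N => // k /= Nk; apply: eU; exact: HN.
Qed.

(** * Derivatives along lines and the descent inequality *)

Lemma derive_dotp (R : realType) (n : nat) (f : 'rV[R]_n -> R) (a d : 'rV[R]_n) :
  differentiable f a -> 'D_d f a = dotp (grad f a) d.
Proof.
move=> df; rewrite deriveE// [in LHS](row_sum_delta d) linear_sum.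
by apply: eq_bigr => i _; rewrite linearZ/= mxE deriveE// mulrC.
Qed.

Lemma is_derive_line (R : realType) (n : nat) (f : 'rV[R]_n -> R)
    (a d : 'rV[R]_n) (t : R) :
  differentiable f (a + t *: d) ->
  is_derive t (1 : R) (fun s => f (a + s *: d)) (dotp (grad f (a + t *: d)) d).
Proof.
move=> df; have dd := @diff_derivable _ _ _ _ _ d df.
have E : (fun h : R => h^-1 *: ((fun s => f (a + s *: d)) (h *: (1 : R) + t)
                         - f (a + t *: d))) =
         (fun h : R => h^-1 *: ((f \o shift (a + t *: d)) (h *: d) - f (a + t *: d))).
  apply/funext => h /=; congr (_ *: (f _ - _)).
  by rewrite [h *: _]mulr1 scalerDl addrCA.
apply: DeriveDef; first by rewrite /derivable /= E.
by rewrite /derive /= E -derive_dotp.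
Qed.

(** Subtracting the linear and quadratic terms from [f] along the segment leaves a function [h]
    whose derivative is nonpositive on the unit interval, by Cauchy-Schwarz and the Lipschitz bound.
    Comparing [h 1] with [h 0] avoids integrating the gradient. *)
Lemma descent (R : realType) (n : nat) (f : 'rV[R]_n -> R) (L : R)
    (a d : 'rV[R]_n) :
  (forall x, differentiable f x) -> lipschitz_gradient f L ->
  f (a + d) <= f a + dotp (grad f a) d + L / 2 * enorm d ^+ 2.
Proof.
move=> df lip.
pose h (t : R) := f (a + t *: d) - t * dotp (grad f a) d
                  - t ^+ 2 * (L / 2 * enorm d ^+ 2).
have dh (t : R) : is_derive t (1 : R) h (dotp (grad f (a + t *: d)) d
   - dotp (grad f a) d - 2 * t * (L / 2 * enorm d ^+ 2)).
  have ? := is_derive_line (df (a + t *: d)).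
  rewrite /h; apply: is_derive_eq.
  by rewrite /GRing.scale/=; ring.
have : h 1 <= h 0.
  apply: (@ler0_derive1_nincr _ h 0 1) => // [t /itvP t01|].
  - rewrite derive1E (@derive_val _ _ _ _ _ _ _ (dh t)) -dotpBl.
    have := dotp_le (grad f (a + t *: d) - grad f a) d.
    have := lip (a + t *: d) a.
    rewrite [_ + _ - a]addrC addKr enormZ ger0_norm ?t01// => h1 h2.
    have := ler_wpM2r (enorm_ge0 d) h1; nra.
  - apply: derivable_within_continuous => t _.
    exact: (@ex_derive _ _ _ _ _ _ _ (dh t)).
rewrite /h scale1r scale0r addr0 mul0r expr0n/= mul0r !subr0 expr1n !mul1r.
lra.
Qed.

(** * Desingularizing functions *)

(* [phi t] is the integral of [1 / psi] over ]0, t]; as [psi] is nondecreasing,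
   the second property plays the role of concavity of [phi]. *)
Lemma desingularizing_function (R : realType) (psi : R -> R) (eta : R) :
  (forall t, 0 < t < eta -> 0 < psi t) ->
  (forall s t, 0 < s -> s <= t -> t < eta -> psi s <= psi t) ->
  (@lebesgue_measure R).-integrable `]0, eta[%classic
    (fun t : R => ((psi t)^-1)%:E) ->
  exists2 phi : R -> R, forall t, 0 < t < eta -> 0 <= phi t &
    forall t s, 0 < t -> t <= s -> s < eta -> (s - t) / psi s <= phi s - phi t.
Proof.
move=> psi0 psimon ipsi.
have sub (s : R) A : s < eta -> A `<=` `]0, s]%classic -> measurable A ->
    (@lebesgue_measure R).-integrable A (EFin \o (fun t : R => (psi t)^-1)).
  move=> se As mA; apply: integrableS ipsi => //.
  apply: subset_trans As _ => u /=; rewrite !in_itv/= => /andP[-> us].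
  exact: le_lt_trans us se.
exists (fun t => \int[lebesgue_measure]_(u in `]0, t]) (psi u)^-1).
  move=> t /andP[t0 te]; apply: Rintegral_ge0 => u /=.
  rewrite in_itv/= => /andP[u0 ut]; rewrite invr_ge0 ltW// psi0// u0/=.
  exact: le_lt_trans ut te.
move=> t s t0 ts se; rewrite Rintegral_itvB ?bnd_simp ?(ltW t0)//; last first.
  exact: (sub s _ se (@subset_refl _ _)).
have ls : `]t, s]%classic `<=` `]0, s]%classic.
  by move=> u /=; rewrite !in_itv/= => /andP[/(lt_trans t0)-> ->].
rewrite (@le_trans _ _ (\int[lebesgue_measure]_(u in `]t, s]) (psi s)^-1))//.
  rewrite Rintegral_cst//= lebesgue_measure_itv/= lte_fin mulrC.
  case: ltP => [//|st].
  by rewrite (le_anti (introT andP (conj ts st))) subrr.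
apply: le_Rintegral => //; last 1 first.
- move=> u /=; rewrite in_itv/= => /andP[tu us].
  have u0 := lt_trans t0 tu.
  rewrite lef_pV2 ?posrE ?psi0//; first exact: psimon.
  + by rewrite (lt_le_trans u0 us).
  + by rewrite u0 (le_lt_trans us).
- apply/integrableP; split; first exact: measurable_cst.
  rewrite integral_cst//= lebesgue_measure_itv/=.
  by case: ifP => _; rewrite ?mule0// -EFinD -EFinM ltry.
- exact: (sub s).
Qed.


Lemma powRN_ge_tangent (R : realType) (s u : R) :
  0 <= s -> 0 < u -> 1 + s * (1 - u) <= u `^ (- s).
Proof.
move=> s0 u0; rewrite /powR gt_eqF//; apply: le_trans (expR_ge1Dx _).
have : ln u <= u - 1.
  by rewrite -[X in ln X](subrKC 1) le_ln1Dx//; lra.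
nra.
Qed.

Lemma powR_mulN (R : realType) (x s : R) : 0 < x -> x `^ s * x `^ (- s) = 1.
Proof. by move=> x0; rewrite powRN divff// gt_eqF// powR_gt0. Qed.

(* The primitive of t |-> 1 / (M t^q) is t^(1-q) / (M (1-q)); the extra factor 2
   lets the tangent inequality for negative exponents suffice. *)
Lemma powR_desingularizing (R : realType) (M q s t : R) :
  0 < M -> 0 < q < 1 -> 0 < t -> t <= s ->
  (s - t) / (M * s `^ q) <=
    2 / (M * (1 - q)) * s `^ (1 - q) - 2 / (M * (1 - q)) * t `^ (1 - q).
Proof.
move=> M0 /andP[q0 q1] t0 ts.
have s0 : 0 < s by exact: lt_le_trans ts.
have p0 : 0 < 1 - q by lra.
have [u [u0 u1 tu]] : exists u, [/\ 0 < u, u <= 1 & t = u * s].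
  exists (t / s); split; first exact: divr_gt0.
    by rewrite ler_pdivrMr// mul1r.
  by rewrite mulfVK// gt_eqF.
have E : s `^ (1 - q) * s `^ q = s by rewrite -powRD ?subrK ?powRr1// ?ltW// gt_eqF// implybT.
have q'0 : 0 < s `^ q by exact: powR_gt0.
have p'0 : 0 < s `^ (1 - q) by exact: powR_gt0.
have -> : (s - t) / (M * s `^ q) = s `^ (1 - q) / M * (1 - u).
  rewrite tu; move: (s `^ (1 - q)) (s `^ q) E q'0 => P Q <- Q0.
  by field; rewrite !gt_eqF.
have -> : 2 / (M * (1 - q)) * s `^ (1 - q) - 2 / (M * (1 - q)) * t `^ (1 - q) =
    s `^ (1 - q) / M * (2 / (1 - q) * (1 - u `^ (1 - q))).
  by rewrite tu powRM ?ltW//; field; rewrite !gt_eqF.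
rewrite ler_pM2l ?divr_gt0// mulrAC ler_pdivlMr//.
have := powRN_ge_tangent (ltW p0) u0.
have := powR_mulN (1 - q) u0.
have := powR_gt0 (1 - q) u0; have := powR_gt0 (- (1 - q)) u0.
set y := u `^ (1 - q); set w := u `^ _ => w0 y0 yw.
have z0 : 0 <= (1 - u) * (1 - q) by nra.
have z1 : (1 - u) * (1 - q) <= 1 by nra.
rewrite (mulrC (1 - q)); move: z0 z1; set z := (1 - u) * _ => z0 z1 zw.
have := ler_wpM2l (ltW y0) zw; rewrite yw => yz.
(* The tangent inequality gives [y * (1 + z) <= 1], and the goal is [z <= 2 * (1 - y)]. If [y] is at
   least 1/2, then [z <= (1 - y) / y] suffices; otherwise [z <= 1] does. This is where the factor 2
   is spent. *)
by have [y1|y1] := leP (1 / 2) y; nra.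
Qed.

(** * Decay rates of real sequences from one-step recursions *)

Lemma geometric_decay (R : realType) (r : nat -> R) (t : R) (K : nat) :
  0 < t -> (forall k, (K <= k)%N -> r k.+1 <= t * r k) ->
  forall k, (K <= k)%N -> r k <= r K / t ^+ K * t ^+ k.
Proof.
move=> t0 H k /subnK<-; elim: (k - K)%N => [|j IH].
  by rewrite add0n mulfVK// expf_neq0// gt_eqF.
rewrite addSn (le_trans (H _ (leq_addl _ _)))// exprS mulrCA.
by rewrite ler_pM2l.
Qed.

(* r^(-s) grows by at least s * c at each step. *)
Lemma polynomial_decay (R : realType) (r : nat -> R) (c s : R) (K : nat) :
  0 < c -> 0 < s -> (forall k, (K <= k)%N -> 0 < r k) ->
  (forall k, (K <= k)%N -> c * r k `^ (1 + s) <= r k - r k.+1) ->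
  exists2 C, 0 < C & forall k, ((2 * K).+1 <= k)%N -> r k <= C * k%:R `^ (- s^-1).
Proof.
move=> c0 s0 r0 H.
have step k : (K <= k)%N -> r k `^ (- s) + s * c <= r k.+1 `^ (- s).
  move=> Kk; have rk := r0 _ Kk; have rk1 := r0 k.+1 (leqW Kk).
  have [u u0 ru] : exists2 u, 0 < u & r k.+1 = u * r k.
    by exists (r k.+1 / r k); rewrite ?divr_gt0// mulfVK// gt_eqF.
  have := H _ Kk; rewrite ru (powRM _ (ltW u0) (ltW rk)).
  rewrite powRD ?(gt_eqF rk) ?implybT// powRr1 ?(ltW rk)//.
  have := powRN_ge_tangent (ltW s0) u0.
  have := powR_mulN s rk; have := powR_gt0 (- s) rk.
  set w := r k `^ (- s); set v := r k `^ s => w0 vw hu.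
  rewrite -{2}(mul1r (r k)) -mulrBl mulrCA [leRHS]mulrC ler_pM2l// => h.
  have {h} : c * v * w <= (1 - u) * w by rewrite ler_pM2r.
  rewrite -mulrA vw mulr1 => h.
  have := ler_wpM2r (ltW w0) hu.
  have := ler_wpM2l (ltW s0) h; nra.
have lin j : s * c * j%:R <= r (j + K)%N `^ (- s).
  elim: j => [|j IH]; first by rewrite mulr0 powR_ge0.
  rewrite addSn (le_trans _ (step _ (leq_addl _ _)))// -natr1 mulrDr mulr1.
  by rewrite lerD2r.
(* The linear growth is in [k - K]. From [2 * K] on, [k - K] is at least [k / 2], which explains
   both the halved constant and the threshold; the successor keeps [k] positive. *)
have sc0 : 0 < s * c / 2 by rewrite divr_gt0// mulr_gt0.
exists ((s * c / 2) `^ (- s^-1)); first exact: powR_gt0.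
move=> k Kk; have Kk' : (K <= k)%N by rewrite (leq_trans _ Kk)// leqW// leq_pmull.
have rk := r0 _ Kk'.
have k0 : 0 < k%:R :> R by rewrite ltr0n (leq_trans _ Kk).
rewrite -(powRM _ (ltW sc0) (ltW k0)).
have -> : r k = (r k `^ (- s)) `^ (- s^-1).
  by rewrite -powRrM mulrNN divff ?gt_eqF// powRr1 ?(ltW rk).
rewrite !(powRN _ s^-1) lef_pV2 ?posrE ?powR_gt0//; last exact: mulr_gt0.
apply: ge0_ler_powR; rewrite ?nnegrE ?powR_ge0 ?invr_ge0 ?(ltW s0)//.
  by rewrite mulr_ge0 ?ltW.
have := lin (k - K)%N; rewrite subnK// natrB// => /(le_trans _); apply.
have : 2 * K%:R <= k%:R :> R by rewrite -natrM ler_nat ltnW.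
have : 0 < s * c by exact: mulr_gt0.
nra.
Qed.

(** * Accumulation points of the iterates and values of [f] there *)

Lemma accumulation_frequently (R : realType) (n : nat) (x : nat -> 'rV[R]_n)
    (a : 'rV[R]_n) :
  accumulation_point x a ->
  forall e N, 0 < e -> exists2 k, (N <= k)%N & enorm (x k - a) < e.
Proof.
move=> xa e N e0.
have [_ [[k Nk <-] /= ke]] := xa [set x k | k in [set k | (N <= k)%N]]
  [set y | enorm (y - a) < e]
  (ex_intro2 _ _ N I (fun k Nk => ex_intro2 _ _ k Nk erefl))
  (proj2 (nbhs_enorm _ _) (ex_intro2 _ _ e e0 (fun _ => id))).
by exists k.
Qed.

Lemma accumulation_exists (R : realType) (n : nat) (x : nat -> 'rV[R]_n) :
  ~ (enorm (x k) @[k --> \oo] --> +oo) -> exists a, accumulation_point x a.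
Proof.
move=> nx; have {nx} [A HA] : exists A, forall N, exists2 k, (N <= k)%N & enorm (x k) < A.
  apply: contrapT => H; apply: nx; apply/cvgryPge => A.
  apply: contrapT => HA; apply: H; exists A => N.
  apply: contrapT => HN; apply: HA; exists N => // k /= Nk.
  by rewrite leNgt; apply/negP => kA; apply: HN; exists k.
(* The tail filter restricted to the indices with norm below [A]. It is proper because such indices
   occur arbitrarily late, it contains a compact box, and its cluster points are accumulation points
   of [x]. *)
pose F : set_system 'rV[R]_n := fun U => exists N, forall k, (N <= k)%N -> enorm (x k) < A -> U (x k).
have PF : ProperFilter F.
  split.
    move=> [N HN]; have [k Nk kA] := HA N; exact: HN Nk kA.
  split.
  - by exists 0%N.
  - move=> P Q [N HN] [N' HN']; exists (maxn N N') => k.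
    by rewrite geq_max => /andP[Nk Nk'] kA; split; [exact: HN|exact: HN'].
  - by move=> P Q PQ [N HN]; exists N => k Nk kA; apply: PQ; exact: HN.
have cK : compact [set v : 'rV[R]_n | forall i, `[- A, A]%classic (v ord0 i)].
  apply: (@rV_compact _ _ (fun=> `[- A, A]%classic)) => _; exact: segment_compact.
have [|a [_ Fa]] := cK F PF.
  exists 0%N => k _ kA i /=; rewrite in_itv/= -ler_norml.
  exact: le_trans (coord_le_enorm _ _) (ltW kA).
exists a => P Q [N _ HN] Qa; apply: Fa => //; exists N => k Nk _; exact: HN.
Qed.

(** Continuity controls the values only at the visits near [a]; monotonicity carries this control to
    all later indices. *)
Lemma values_at_accumulation (R : realType) (n : nat) (f : 'rV[R]_n -> R)
    (x : nat -> 'rV[R]_n) (a : 'rV[R]_n) :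
  continuous f -> (forall k, (1 <= k)%N -> f (x k.+1) < f (x k)) ->
  accumulation_point x a ->
  (forall k, (1 <= k)%N -> 0 < f (x k) - f a) /\
  forall e, 0 < e -> exists N, forall k, (N <= k)%N -> f (x k) - f a < e.
Proof.
move=> cf fx xa.
have mon k m : (1 <= k)%N -> (k <= m)%N -> f (x m) <= f (x k).
  move=> k1 /subnK<-; elim: (m - k)%N => // j IH.
  apply: le_trans IH; rewrite addSn ltW// fx//.
  by rewrite (leq_trans k1)// leq_addl.
split=> [k k1|e e0].
  (* Strict positivity comes from passing to the next iterate: [f a <= f (x k.+1)], as otherwise a
     later visit near [a] would have a value above [f (x k.+1)]. *)
  rewrite subr_gt0 (le_lt_trans _ (fx _ k1))// leNgt; apply/negP => fka.
  have /nbhs_enorm[d d0 Hd] : nbhs a [set y | f (x k.+1) < f y].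
    exact: (cvgr_gt (f a) (cf a)).
  have [m km /Hd /=] := accumulation_frequently xa k.+1 d0.
  by rewrite ltNge mon.
have /nbhs_enorm[d d0 Hd] : nbhs a [set y | f y < f a + e].
  by apply: (cvgr_lt (f a) (cf a)); rewrite ltrDl.
have [m m1 /Hd /= fm] := accumulation_frequently xa 1%N d0.
exists m => k mk; rewrite ltrBlDl; exact: le_lt_trans (mon _ _ m1 mk) fm.
Qed.


(** * Sufficient decrease in one iteration *)

(** The two tests bound the gradient error by [mu^-1 * enorm (g k)]. The descent inequality with
    step [L^-1] then gains [1 - mu^-1] from the linear term and loses 1/2 to the quadratic one, so
    the decrease constant is positive exactly when [mu > 2]. *)
Lemma igd_step (R : realType) (n : nat) (f : 'rV[R]_n -> R)
    (L theta mu : R) (x g : nat -> 'rV[R]_n) (eps : nat -> R) :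
  (forall y, differentiable f y) -> 0 < L -> lipschitz_gradient f L ->
  0 < theta < 1 -> 2 < mu -> igd_sequences f L theta mu x g eps ->
  forall k, (1 <= k)%N ->
  [/\ 0 < eps k.+1 /\ eps k.+1 <= eps k,
      mu * eps k.+1 < enorm (g k),
      enorm (grad f (x k)) <= 2 * enorm (g k),
      x k.+1 = x k - L^-1 *: g k &
      (1 / 2 - mu^-1) / L * enorm (g k) ^+ 2 <= f (x k) - f (x k.+1)].
Proof.
move=> df L0 lip /andP[th0 th1] mu2 [eps1 [i H]].
have pos k : (1 <= k)%N -> 0 < eps k.
  case: k => // k _; elim: k => // k IH.
  by have [_ _ ->] := H k.+1 isT; rewrite mulr_gt0// exprn_gt0.
move=> k k1; have [[gG mug _] xk ek] := H k k1; rewrite -ek in gG mug.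
have e0 := pos k.+1 isT.
have mu0 : 0 < mu by lra.
split=> //.
- by split=> //; rewrite ek ler_piMl ?(ltW (pos _ k1))// exprn_ile1 ?(ltW th0) ?(ltW th1).
- have := enormD (grad f (x k) - g k) (g k); rewrite subrK enorm_distC => h.
  have : eps k.+1 <= enorm (g k) by nra.
  by move: h gG; lra.
have hd := descent (x k) (- (L^-1 *: g k)) df lip.
rewrite -xk in hd.
have E : enorm (- (L^-1 *: g k)) = L^-1 * enorm (g k).
  by rewrite enormN enormZ ger0_norm// invr_ge0 ltW.
have E2 : dotp (grad f (x k)) (- (L^-1 *: g k)) = - (L^-1 * dotp (grad f (x k)) (g k)).
  by rewrite -scaleNr dotpZr mulNr.
rewrite E E2 in hd.
(* Write the gradient as [g k] minus the error and apply Cauchy-Schwarz to the error term. *)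
have hdot : enorm (g k) ^+ 2 - mu^-1 * enorm (g k) ^+ 2 <= dotp (grad f (x k)) (g k).
  rewrite -{1}[grad f (x k)](subKr (g k)) dotpBl -enorm_sqr lerD2l lerN2.
  rewrite (le_trans (dotp_le _ _))// expr2 mulrA ler_wpM2r ?enorm_ge0//.
  by rewrite (le_trans gG)// mulrC ler_pdivlMr// mulrC ltW.
have l0 : 0 < L^-1 by rewrite invr_gt0.
have E3 : L / 2 * (L^-1 * enorm (g k)) ^+ 2 = L^-1 * (enorm (g k) ^+ 2 / 2).
  by field; rewrite gt_eqF.
rewrite E3 in hd; have := ler_wpM2l (ltW l0) hdot; lra.
Qed.

(** * Trapping of the iterates under the KL property *)

(* phi (f (x k) - f a) is nonincreasing and bounded below, so its tails are small:
   phi need not vanish at 0. *)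
Lemma KL_trapping (R : realType) (n : nat) (f : 'rV[R]_n -> R)
    (x : nat -> 'rV[R]_n) (a : 'rV[R]_n) (b eta : R) (psi phi : R -> R)
    (U : set 'rV[R]_n) :
  continuous f -> 0 < b -> 0 < eta -> accumulation_point x a -> nbhs a U ->
  (forall k, (1 <= k)%N -> f (x k.+1) < f (x k)) ->
  (forall k, (1 <= k)%N -> b * enorm (x k.+1 - x k) * enorm (grad f (x k))
                           <= f (x k) - f (x k.+1)) ->
  (forall t, 0 < t < eta -> 0 < psi t) ->
  (forall t, 0 < t < eta -> 0 <= phi t) ->
  (forall t s, 0 < t -> t <= s -> s < eta -> (s - t) / psi s <= phi s - phi t) ->
  (forall y, U y -> f a < f y < f a + eta -> psi (f y - f a) <= enorm (grad f y)) ->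
  forall d, 0 < d -> exists2 K, (1 <= K)%N &
    (forall k, (K <= k)%N ->
       [/\ U (x k), enorm (x k - a) < d & 0 < f (x k) - f a < eta]) /\
    (forall k m, (K <= k)%N -> (k <= m)%N ->
       b * enorm (x m - x k) <= phi (f (x k) - f a) - phi (f (x m) - f a)).
Proof.
move=> cf b0 eta0 xa /nbhs_enorm[d1 d10 d1U] fx fb psi0 phi0 phipsi KL d d0.
have [r0 rcvg] := values_at_accumulation cf fx xa.
have [N HN] := rcvg _ eta0.
pose N1 := maxn 1 N; pose r k := f (x k) - f a.
have rN k : (N1 <= k)%N -> 0 < r k < eta.
  by rewrite geq_max => /andP[k1 Nk]; rewrite r0// HN.
have N1_ge1 k : (N1 <= k)%N -> (1 <= k)%N by rewrite geq_max => /andP[].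
have step k : (N1 <= k)%N -> (r k - r k.+1) / psi (r k) <= phi (r k) - phi (r k.+1).
  move=> k1; apply: phipsi; first by case/andP: (rN _ (leqW k1)).
    by rewrite lerD2r ltW// fx// N1_ge1.
  by case/andP: (rN _ k1).
have rstep k : r k - r k.+1 = f (x k) - f (x k.+1) by rewrite /r; lra.
(* Inside [U] the KL inequality lets the gradient norm in the decrease estimate be replaced by
   [psi (r k)]; dividing by it bounds the step length by an increment of [phi]. *)
have Ustep k : (N1 <= k)%N -> U (x k) ->
    b * enorm (x k.+1 - x k) <= phi (r k) - phi (r k.+1).
  move=> k1 Uk; apply: le_trans (step _ k1).
  have pk := psi0 _ (rN _ k1).
  rewrite ler_pdivlMr// rstep (le_trans _ (fb _ (N1_ge1 _ k1)))//.
  rewrite ler_wpM2l ?mulr_ge0 ?enorm_ge0 ?(ltW b0)// KL//.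
  by have := rN _ k1; rewrite subr_gt0 ltrBlDl.
have mon k m : (N1 <= k)%N -> (k <= m)%N -> phi (r m) <= phi (r k).
  move=> k1 /subnK<-; elim: (m - k)%N => // j; apply: le_trans.
  have kj : (N1 <= j + k)%N by rewrite (leq_trans k1)// leq_addl.
  rewrite -subr_ge0 addSn; apply: le_trans (step _ kj).
  by rewrite divr_ge0 ?(ltW (psi0 _ (rN _ kj)))// rstep subr_ge0 ltW// fx// N1_ge1.
pose e := Num.min d d1.
have e0 : 0 < e by rewrite lt_min d0.
pose S := [set phi (r k) | k in [set k | (N1 <= k)%N]].
have lS : has_lbound S by exists 0 => _ [k k1 <-]; exact/phi0/rN.
have be0 : 0 < b * (e / 2) by rewrite mulr_gt0 ?divr_gt0.
have iS : has_inf S by split => //; exists (phi (r N1)); exists N1 => /=.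
have [_ [N2 /= N2N1 <-] HN2] := inf_adherent be0 iS.
have [K KN2 xK] := accumulation_frequently xa N2 (divr_gt0 e0 (ltr0Sn R 1)).
have KN1 : (N1 <= K)%N by exact: leq_trans KN2.
have phiK m : (K <= m)%N -> phi (r K) - phi (r m) < b * (e / 2).
  move=> Km; have : inf S <= phi (r m).
    by apply: ge_inf => //; exists m => //=; exact: leq_trans Km.
  by have := mon _ _ N2N1 KN2; lra.
have close m : (K <= m)%N -> b * enorm (x m - x K) <= phi (r K) - phi (r m) ->
    enorm (x m - a) < e.
  move=> Km h; rewrite (le_lt_trans (enorm_triangle _ (x K) _))//.
  have : enorm (x m - x K) < e / 2.
    by rewrite -(ltr_pM2l b0) (le_lt_trans h)// phiK.
  by move: xK; lra.
have inU m : enorm (x m - a) < e -> U (x m).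
  by rewrite lt_min => /andP[_ /d1U].
have path k m : (K <= k)%N -> (k <= m)%N ->
    (forall i, (k <= i)%N -> (i < m)%N -> U (x i)) ->
    b * enorm (x m - x k) <= phi (r k) - phi (r m).
  move=> Kk /subnK<-; elim: (m - k)%N => [_|j IH HU].
    by rewrite add0n !subrr enorm0 mulr0.
  have kj : (N1 <= j + k)%N by rewrite (leq_trans KN1)// (leq_trans Kk)// leq_addl.
  have /Ustep-/(_ kj) h1 : U (x (j + k)%N).
    by apply: HU; rewrite ?leq_addl// addSn.
  have h2 := IH (fun i ki ij => HU i ki (ltnW ij)).
  rewrite addSn in h1 *.
  have := ler_wpM2l (ltW b0) (enorm_triangle (x (j + k).+1) (x (j + k)%N) (x k)).
  by rewrite mulrDr; move: h1 h2; lra.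
(* Strong induction closes the loop: while the earlier iterates from [K] on lie in [U], the bound on
   the distance travelled keeps the next one within [e] of [a], hence in [U]. *)
have near m : (K <= m)%N -> enorm (x m - a) < e.
  have [p] := ubnP m; elim: p m => // p IH m mp Km.
  apply: close => //; apply: path => // i Ki im.
  by apply/inU/IH => //; exact: leq_trans im _.
exists K; first exact: N1_ge1.
split=> [k Kk|k m Kk km].
  split; first exact/inU/near.
    by have := near _ Kk; rewrite lt_min => /andP[].
  by apply: rN; exact: leq_trans KN1 _.
apply: path => // i ki _; apply: inU; apply: near; exact: leq_trans ki.
Qed.

(** * Quantitative estimates for power desingularization *)

Lemma converges_linearlyI (R : realType) (V : zmodType) (N : V -> R)
    (z : nat -> V) (zbar : V) (c t : R) (K : nat) :
  0 < c -> 0 < t < 1 -> (forall k, (K <= k)%N -> N (z k - zbar) <= c * t ^+ k) ->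
  converges_linearly N z zbar.
Proof. by move=> c0 t01 H; exists c, t; split => //; exists K. Qed.

Lemma eqO_oo (R : realType) (u v : nat -> R) (C : R) (K : nat) :
  0 < C -> (forall k, (K <= k)%N -> 0 <= u k <= C * v k) -> u =O_\oo v.
Proof.
move=> C0 H; apply/eqO_exP; exists C => //; exists K => // k /= Kk.
have /andP[uk ukv] := H k Kk.
by rewrite ger0_norm// (le_trans ukv)// ler_pM2l// ler_norm.
Qed.


(** Gathers everything about the iterates that both rate regimes use: distances and gradients are
    controlled by a power of the value gap, and the gap obeys a scalar recursion, obtained by
    squaring the KL inequality in the decrease estimate. *)
Lemma KL_power_estimates (R : realType) (n : nat) (f : 'rV[R]_n -> R)
    (x : nat -> 'rV[R]_n) (a : 'rV[R]_n) (L b c M q : R) :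
  continuous f -> 0 < L -> lipschitz_gradient f L -> 0 < b -> 0 < c ->
  accumulation_point x a -> 0 < M -> 0 < q < 1 ->
  (forall k, (1 <= k)%N -> f (x k.+1) < f (x k)) ->
  (forall k, (1 <= k)%N -> b * enorm (x k.+1 - x k) * enorm (grad f (x k))
                           <= f (x k) - f (x k.+1)) ->
  (forall k, (1 <= k)%N -> c * enorm (grad f (x k)) ^+ 2 <= f (x k) - f (x k.+1)) ->
  (forall e, 0 < e -> exists N, forall k, (N <= k)%N -> enorm (grad f (x k)) < e) ->
  KL_property_with f a (fun t => M * t `^ q) ->
  exists K D c', [/\ 0 < D, 0 < c' & forall k, (K <= k)%N ->
    [/\ 0 < f (x k) - f a <= 1,
        enorm (x k - a) <= D * (f (x k) - f a) `^ (1 - q),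
        enorm (grad f (x k)) <= L * D * (f (x k) - f a) `^ (1 - q) &
        c' * (f (x k) - f a) `^ (2 * q) <= (f (x k) - f a) - (f (x k.+1) - f a)]].
Proof.
move=> cf L0 lip b0 c0 xa M0 /[dup] q01 /andP[q0 q1] fx fb fc gcvg.
move=> [eta [U [[eta0 aU] psi0 _ _ KL]]].
have [r0 rcvg] := values_at_accumulation cf fx xa.
(* The threshold 1 serves the linear regime, where the gap must be at most its power [2 * q]. *)
have [N HN] := rcvg _ ltr01.
pose A := 2 / (M * (1 - q)).
have A0 : 0 < A by rewrite divr_gt0// mulr_gt0// subr_gt0.
have trap := KL_trapping cf b0 eta0 xa aU fx fb psi0
  (fun t _ => mulr_ge0 (ltW A0) (powR_ge0 t (1 - q)))
  (fun t s t0 ts _ => powR_desingularizing M0 q01 t0 ts) KL.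
have [K K1 [HK Hlen]] := trap _ ltr01.
(* For every [e] some later iterate is within [e] of [a], and its distance from [x k] is at most
   [phi] of the current gap divided by [b]; then [e] is arbitrary. *)
have dist k : (K <= k)%N -> enorm (x k - a) <= A / b * (f (x k) - f a) `^ (1 - q).
  move=> Kk; apply/ler_addgt0Pr => e e0.
  have [K' _ [HK' _]] := trap _ e0.
  have km : (k <= maxn k K')%N by rewrite leq_maxl.
  have [_ xm rm] := HK' (maxn k K') (leq_maxr _ _).
  rewrite (le_trans (enorm_triangle _ (x (maxn k K')) _))// lerD//; last exact: ltW.
  rewrite enorm_distC mulrAC ler_pdivlMr// mulrC (le_trans (Hlen _ _ Kk km))//.
  by rewrite gerBl mulr_ge0 ?powR_ge0 ?(ltW A0).
(* Gradients along the iterates tend to 0 and the Lipschitz bound transfers this to [a]; hence the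
   gradient at [x k] is at most [L] times the distance to [a]. *)
have ga0 : grad f a = 0.
  apply: enorm_eq0; apply/le_anti; rewrite enorm_ge0 andbT.
  apply/ler_addgt0Pr => e e0; rewrite add0r.
  have e2 : 0 < e / 2 by rewrite divr_gt0.
  have [N1 HN1] := gcvg _ e2.
  have [k kN1] := accumulation_frequently xa N1 (divr_gt0 e2 L0).
  rewrite ltr_pdivlMr// mulrC => xk.
  have := lip a (x k); rewrite enorm_distC (enorm_distC a).
  have := enorm_triangle 0 (grad f (x k)) (grad f a).
  rewrite !sub0r !enormN; move: (HN1 _ kN1) xk; lra.
exists (maxn K N), (A / b), (c * M ^+ 2).
split; [exact: divr_gt0|by rewrite mulr_gt0// exprn_gt0|].
move=> k; rewrite geq_max => /andP[Kk Nk].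
have k1 : (1 <= k)%N by exact: leq_trans K1 Kk.
have [Uk _ /andP[rk reta]] := HK _ Kk.
split.
- by rewrite rk ltW// HN.
- exact: dist.
- rewrite -[grad f (x k)]subr0 -ga0 -mulrA (le_trans (lip _ _))//.
  by rewrite ler_pM2l// dist.
- have -> : f (x k) - f a - (f (x k.+1) - f a) = f (x k) - f (x k.+1) by lra.
  rewrite (le_trans _ (fc _ k1))// -mulrA ler_pM2l//.
  rewrite mulrC (mulrC 2) powRrM powR_mulrn ?powR_ge0// -exprMn mulrC.
  rewrite ler_pXn2r ?nnegrE ?enorm_ge0 ?mulr_ge0 ?powR_ge0 ?(ltW M0)//.
  by apply: KL => //; move: rk reta; lra.
Qed.

(** * The dichotomy, convergence, and the two rate regimes *)

Theorem theorem3p4 (R : realType) (n : nat) (f : 'rV[R]_n -> R)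
    (L theta mu : R) (x g : nat -> 'rV[R]_n) (eps : nat -> R)
    (hf : C1_smooth f) (hL : 0 < L) (hLip : lipschitz_gradient f L)
    (htheta : 0 < theta < 1) (hmu : 2 < mu)
    (higd : igd_sequences f L theta mu x g eps)
    (hgrad : forall k, (1 <= k)%N -> grad f (x k) <> 0) :
  enorm (x k) @[k --> \oo] --> +oo
  \/
  [/\ (* eps_k decreases to 0 *)
      (forall k, (1 <= k)%N -> eps k.+1 <= eps k)
        /\ eps k @[k --> \oo] --> (0 : R),
      (* (i) *)
      grad f (x k) @[k --> \oo] --> (0 : 'rV[R]_n)
        /\ g k @[k --> \oo] --> (0 : 'rV[R]_n),
      (* (ii) *)
      forall xbar, accumulation_point x xbar -> KL_property f xbar ->
        x k @[k --> \oo] --> xbar &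
      (* (iii) *)
      forall (xbar : 'rV[R]_n) (M q : R),
        accumulation_point x xbar -> 0 < M -> 0 < q < 1 ->
        KL_property_with f xbar (fun t => M * t `^ q) ->
        (q <= 1 / 2 ->
          [/\ converges_linearly (@enorm R n) x xbar,
              converges_linearly (fun r : R => `|r|) (fun k => f (x k)) (f xbar) &
              converges_linearly (@enorm R n) (fun k => grad f (x k)) 0])
        /\
        (1 / 2 < q ->
          [/\ (fun k => enorm (x k - xbar)) =O_\oo
                (fun k => k%:R `^ (- ((1 - q) / (2 * q - 1)))),
              (fun k => f (x k) - f xbar) =O_\oo
                (fun k => k%:R `^ (- ((2 - 2 * q) / (2 * q - 1)))) &
              (fun k => enorm (grad f (x k))) =O_\oo
                (fun k => k%:R `^ (- ((1 - q) / (2 * q - 1))))])].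
Proof.
have [df _] := hf.
have cf : continuous f by move=> y; exact: differentiable_continuous.
have [|nx] := pselect (enorm (x k) @[k --> \oo] --> +oo); [by left|right].
have [a xa] := accumulation_exists nx.
have step := igd_step df hL hLip htheta hmu higd.
have mu0 : 0 < mu by lra.
pose al := (1 / 2 - mu^-1) / L.
have al0 : 0 < al.
  by rewrite divr_gt0// subr_gt0 div1r ltf_pV2 ?posrE.
have g0 k : (1 <= k)%N -> 0 < enorm (g k).
  by case/step => -[ek _] gk _ _ _; apply: lt_trans gk; exact: mulr_gt0.
have fx k : (1 <= k)%N -> f (x k.+1) < f (x k).
  move=> k1; have [_ _ _ _] := step _ k1; rewrite -subr_gt0; apply: lt_le_trans.
  by rewrite mulr_gt0// exprn_gt0// g0.
have [r0 rcvg] := values_at_accumulation cf fx xa.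
have gcvg e : 0 < e -> exists N, forall k, (N <= k)%N -> enorm (g k) < e.
  move=> e0; have [N HN] := rcvg _ (mulr_gt0 al0 (exprn_gt0 2 e0)).
  exists N.+1 => k Nk; have k1 : (1 <= k)%N by exact: leq_trans Nk.
  have [_ _ _ _] := step _ k1.
  have := HN _ (ltnW Nk); have := r0 k.+1 isT.
  rewrite -/al => h1 h2 h3.
  rewrite -(ltr_pXn2r (ltn0Sn 1)) ?nnegrE ?enorm_ge0 ?(ltW e0)//.
  by rewrite -(ltr_pM2l al0); lra.
have Gcvg e : 0 < e -> exists N, forall k, (N <= k)%N -> enorm (grad f (x k)) < e.
  move=> e0; have e2 : 0 < e / 2 by rewrite divr_gt0.
  have [N HN] := gcvg _ e2; exists N.+1 => k Nk.
  have [_ _ Gk _ _] := step _ (leq_trans (ltn0Sn N) Nk).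
  by have := HN _ (ltnW Nk); lra.
(* The step has length [L^-1 * enorm (g k)] and the gradient norm is at most [2 * enorm (g k)],
   whence the constant [al * L / 2]; the same bound squared gives [al / 4] below. *)
have fb k : (1 <= k)%N -> al * L / 2 * enorm (x k.+1 - x k) * enorm (grad f (x k))
                           <= f (x k) - f (x k.+1).
  move=> k1; have [_ _ Gk xk] := step _ k1; rewrite -/al; apply: le_trans.
  have -> : enorm (x k.+1 - x k) = L^-1 * enorm (g k).
    by rewrite xk addrC addKr enormN enormZ ger0_norm// invr_ge0 ltW.
  have -> : al * L / 2 * (L^-1 * enorm (g k)) * enorm (grad f (x k)) =
      al * (enorm (g k) * (enorm (grad f (x k)) / 2)) by field; rewrite gt_eqF.
  rewrite ler_pM2l// expr2 ler_wpM2l ?enorm_ge0//; lra.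
have fc k : (1 <= k)%N -> al / 4 * enorm (grad f (x k)) ^+ 2 <= f (x k) - f (x k.+1).
  move=> k1; have [_ _ Gk _] := step _ k1; rewrite -/al; apply: le_trans.
  rewrite -mulrA ler_pM2l//; have := enorm_ge0 (grad f (x k)); nra.
have b0 : 0 < al * L / 2 by rewrite divr_gt0// mulr_gt0.
have c0 : 0 < al / 4 by rewrite divr_gt0.
split.
- split=> [k /step[[]]//|].
  apply/cvgrPdist_lt => e e0; have [N HN] := gcvg _ e0.
  (* The error accepted at iteration [k] is stored as [eps k.+1], so [eps] is bounded through the
     previous direction and the index shifts by one. *)
  exists N.+2 => // -[//|k] /= Nk; have [[ek _] gk _ _ _] := step _ (leq_trans (ltn0Sn N) Nk).
  rewrite sub0r normrN gtr0_norm//; have := HN _ (ltnW Nk); nra.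
- split; apply: cvg_enorm => e e0.
    by have [N HN] := Gcvg _ e0; exists N => k /HN; rewrite subr0.
  by have [N HN] := gcvg _ e0; exists N => k /HN; rewrite subr0.
- move=> z xz [psi [eta [U [[eta0 zU] psi0 psimon psiint KL]]]].
  have [phi phi0 phipsi] := desingularizing_function psi0 psimon psiint.
  apply: cvg_enorm => e e0.
  have [K _ [HK _]] := KL_trapping cf b0 eta0 xz zU fx fb psi0 phi0 phipsi KL e0.
  by exists K => k /HK[].
move=> z M q xz M0 q01 KL; have /andP[q0 q1] := q01.
have [K [D [c [D0 {c0} c0 H]]]] :=
  KL_power_estimates cf hL hLip b0 c0 xz M0 q01 fx fb fc Gcvg KL.
pose r k := f (x k) - f z.
have p0 : 0 < 1 - q by lra.
have rp k : (K <= k)%N -> 0 < r k by move=> /H[/andP[]].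
have bound k B w : (K <= k)%N -> 0 < B -> 0 < w -> r k <= B * w ->
    enorm (x k - z) <= D * B `^ (1 - q) * w `^ (1 - q) /\
    enorm (grad f (x k)) <= L * D * B `^ (1 - q) * w `^ (1 - q).
  move=> Kk B0 w0 rB; have [_ h1 h2 _] := H _ Kk.
  have h : r k `^ (1 - q) <= B `^ (1 - q) * w `^ (1 - q).
    rewrite -powRM ?(ltW B0) ?(ltW w0)//; apply: ge0_ler_powR => //.
    - exact: ltW.
    - by rewrite nnegrE ltW// rp.
    - by rewrite nnegrE mulr_ge0 ?ltW.
  split; rewrite -mulrA.
    by rewrite (le_trans h1)// ler_pM2l.
  by rewrite (le_trans h2)// ler_pM2l// mulr_gt0.
split=> hq.
  (* The maximum with 1/2 keeps the ratio positive even if [c] is at least 1. *)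
  pose t := Num.max (1 - c) (1 / 2).
  have t01 : 0 < t < 1.
    rewrite lt_max gt_max; apply/andP; split; [apply/orP; right|apply/andP; split]; lra.
  have /andP[t0 t1] := t01.
  have rt k : (K <= k)%N -> r k.+1 <= t * r k.
    move=> Kk; have [rk1 _ _] := H _ Kk; rewrite -/(r k) -/(r k.+1) => hr.
    have rk := rp _ Kk.
    (* As [r k] is at most 1 and [2 * q <= 1], the recursion dominates the linear one
       [c * r k <= r k - r k.+1]. *)
    have : r k <= r k `^ (2 * q) by apply: ger1_powR => //; lra.
    rewrite -(ler_pM2l c0) => hc.
    apply: (@le_trans _ _ ((1 - c) * r k)); first by lra.
    by rewrite ler_pM2r// le_max lexx.
  have geo := geometric_decay t0 rt.
  have B0 : 0 < r K / t ^+ K by rewrite divr_gt0 ?exprn_gt0 ?rp.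
  have tp k : (t ^+ k) `^ (1 - q) = (t `^ (1 - q)) ^+ k.
    by rewrite -!powR_mulrn ?powR_ge0 ?(ltW t0)// -!powRrM mulrC.
  have tq01 : 0 < t `^ (1 - q) < 1.
    have : t `^ (1 - q) < 1 `^ (1 - q).
      by apply: gt0_ltr_powR; rewrite ?nnegrE// ltW.
    by rewrite powR1 powR_gt0.
  have BB := fun k Kk => bound k _ _ Kk B0 (exprn_gt0 k t0) (geo k Kk).
  split.
  - apply: (converges_linearlyI (c := D * (r K / t ^+ K) `^ (1 - q)) (K := K) _ tq01) => [|k Kk]; last first.
      by rewrite -tp; have [] := BB k Kk.
    by rewrite mulr_gt0// powR_gt0.
  - apply: (converges_linearlyI (K := K) B0 t01) => k Kk.
    by rewrite ger0_norm ?geo// ltW// rp.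
  - apply: (converges_linearlyI (c := L * D * (r K / t ^+ K) `^ (1 - q)) (K := K) _ tq01) => [|k Kk]; last first.
      by rewrite subr0 -tp; have [] := BB k Kk.
    by rewrite !mulr_gt0// powR_gt0.
(* Chosen so that [1 + s] is the exponent [2 * q] of the recursion. *)
pose s := 2 * q - 1.
have s0 : 0 < s by rewrite /s; lra.
have dec k : (K <= k)%N -> c * r k `^ (1 + s) <= r k - r k.+1.
  by case/H => _ _ _; rewrite /s subrKC.
have [C C0 HC] := polynomial_decay c0 s0 rp dec.
have ge1 k : ((2 * K).+1 <= k)%N -> (K <= k)%N /\ 1 <= k%:R :> R.
  move=> Kk; split; first by rewrite (leq_trans _ Kk)// leqW// leq_pmull.
  by rewrite ler1n (leq_trans _ Kk).
have wp k : (k%:R `^ (- s^-1)) `^ (1 - q) = k%:R `^ (- ((1 - q) / s)) :> R.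
  by rewrite -powRrM mulNr mulrC.
have BB k Kk := bound k _ _ (ge1 k Kk).1 C0
  (powR_gt0 (- s^-1) (lt_le_trans ltr01 (ge1 k Kk).2)) (HC k Kk).
split.
- apply: (@eqO_oo _ _ _ (D * C `^ (1 - q)) (2 * K).+1) => [|k Kk].
    by rewrite mulr_gt0// powR_gt0.
  by rewrite enorm_ge0 -wp; have [] := BB k Kk.
- apply: (@eqO_oo _ _ _ C (2 * K).+1) => // k Kk; have [Kk' k1] := ge1 _ Kk.
  rewrite (ltW (rp _ Kk'))/= (le_trans (HC _ Kk))// ler_pM2l//.
  (* The recursion yields the exponent [- s^-1], at least as good as the stated one because
     [2 - 2 * q <= 1]. *)
  apply: ler_powR => //; rewrite lerN2 -[leRHS]mul1r ler_pM2r ?invr_gt0//.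
  by move: hq; lra.
- apply: (@eqO_oo _ _ _ (L * D * C `^ (1 - q)) (2 * K).+1) => [|k Kk].
    by rewrite !mulr_gt0// powR_gt0.
  by rewrite enorm_ge0 -wp; have [] := BB k Kk.
Qed.
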